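(* Let $\alpha$ be a Perron number of degree $r$ with conjugates $\alpha_1=\alpha,\alpha_2,\dots,\alpha_r$, and let $\iota:\mathbb{N}_0^{r-1}\to\Omega_0$, $\kappa\mapsto s_\kappa$, be its indexation map. Then $$\#\iota^{-1}(\{0\})=1.$$
   Context: $\mathbb{N}_0=\{0,1,2,\dots\}$. A Perron number is a real algebraic integer $\alpha>1$ such that all of its other conjugates are strictly smaller than $\alpha$ in modulus. The degree and conjugates are taken over $\mathbb{Q}$. For a multi-index $\kappa=(\kappa_2,\dots,\kappa_r)\in\mathbb{N}_0^{r-1}$ (indexed from $2$ to $r$), put $|\kappa|=\kappa_2+\dots+\kappa_r$ and $$s_\kappa=-|\kappa|+\frac{\log|\alpha_2^{\kappa_2}\cdots\alpha_r^{\kappa_r}|}{\log\alpha}+i\,\frac{\arg(\alpha_2^{\kappa_2}\cdots\alpha_r^{\kappa_r})}{\log\alpha},$$ where $\arg$ is the principal argument with values in $(-\pi,\pi]$. Let $\Omega_0=\{s\in\mathbb{C} : -\frac{\pi}{\log\alpha}<\Im(s)\le\frac{\pi}{\log\alpha}\}$. The indexation map is $\iota:\mathbb{N}_0^{r-1}\to\Omega_0$, $\iota(\kappa)=s_\kappa$. *)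

(* Defs.v *)
From HB Require Import structures.
From mathcomp Require Import all_boot all_order all_algebra.
From mathcomp Require Import all_classical all_reals all_analysis.
From mathcomp Require Import complex.

Set Implicit Arguments.
Unset Strict Implicit.
Unset Printing Implicit Defensive.

Import Order.TTheory GRing.Theory Num.Theory.
Import numFieldNormedType.Exports.

Local Open Scope classical_set_scope.
Local Open Scope ring_scope.
Local Open Scope complex_scope.

Section Conjugates.
Context {R : realType}.
Implicit Types (z w : R[i]) (p : {poly rat}).

Definition is_minpolyQ p z : Prop :=
  [/\ p \is monic, irreducible_poly p & root (map_poly ratr p) z].

Definition conjugateQ z w : Prop :=
  exists2 p, is_minpolyQ p z & root (map_poly ratr p) w.

Definition degreeQ z (r : nat) : Prop :=
  exists2 p, is_minpolyQ p z & size p = r.+1.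

(* [s] lists the conjugates of [z], [z] included, without repetition. *)
Definition lists_conjugatesQ z (s : seq R[i]) : Prop :=
  uniq s /\ forall w, w \in s <-> conjugateQ z w.

Definition algebraic_integer z : Prop := integralOver (intr : int -> R[i]) z.

(* The modulus as an element of [R] (the norm [`|z|] of [R[i]] lives in
   [R[i]]). *)
Definition modulus z : R := complex.Re `|z|.

Definition Perron (alpha : R) : Prop :=
  [/\ algebraic_integer alpha%:C, 1 < alpha &
      forall w, conjugateQ alpha%:C w -> w != alpha%:C -> modulus w < alpha].

End Conjugates.

Section PrincipalArgument.
Context {R : realType}.
Implicit Types (z : R[i]) (t : R).

Definition is_Arg z t : Prop :=
  - pi < t <= pi /\ z = (modulus z * cos t) +i* (modulus z * sin t).

(* For [z != 0] this is the unique such [t]; [Arg 0] is an unspecified element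
   of ]-pi, pi]. *)
Definition Arg z : R := xget 0 [set t | is_Arg z t].

Lemma modulusE z :
  modulus z = Num.sqrt (complex.Re z ^+ 2 + complex.Im z ^+ 2).
Proof. by rewrite /modulus normc_def. Qed.

Lemma Arg_exists z : exists t, is_Arg z t.
Proof.
case: z => a b; rewrite /is_Arg modulusE /=.
set m := Num.sqrt _.
have [m0|m0] := eqVneq m 0.
  exists 0; rewrite oppr_lt0 pi_gt0 pi_ge0; split => //.
  rewrite m0 !mul0r; move/eqP: m0; rewrite sqrtr_eq0 => ab0.
  have := paddr_eq0 (sqr_ge0 a) (sqr_ge0 b).
  by rewrite !sqrf_eq0 eq_le ab0 addr_ge0 ?sqr_ge0//= => /esym/andP[/eqP-> /eqP->].
have mp : 0 < m by rewrite lt_def m0 sqrtr_ge0.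
have m2 : m ^+ 2 = a ^+ 2 + b ^+ 2 by rewrite sqr_sqrtr// addr_ge0// sqr_ge0.
pose x := a / m.
have am : m * x = a by rewrite /x mulrC divfK.
have bm : m * Num.sqrt (1 - x ^+ 2) = `|b|.
  rewrite -[m in LHS](ger0_norm (ltW mp)) -sqrtr_sqr -sqrtrM ?sqr_ge0//.
  by rewrite mulrBr mulr1 -exprMn am m2 addrC addKr sqrtr_sqr.
have xB : -1 <= x <= 1.
  by rewrite -ler_norml -(@expr_le1 _ 2)// real_normK ?num_real//
     -(ler_pM2l (exprn_gt0 2 mp)) -exprMn am mulr1 m2 lerDl sqr_ge0.
have [b0|b0] := leP 0 b.
  exists (acos x); split.
    by rewrite acos_lepi// andbT (lt_le_trans _ (acos_ge0 xB))// oppr_lt0 pi_gt0.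
  by rewrite acosK ?in_itv// sin_acos// am bm ger0_norm.
exists (- acos x); split.
  rewrite (@le_trans _ _ 0) ?pi_ge0 ?oppr_le0 ?acos_ge0// andbT ltrN2.
  rewrite acos_ltpi//; case/andP: xB => + ->; rewrite le_eqVlt andbT.
  case/orP => // /eqP x1; move: bm; rewrite -x1 sqrrN expr1n subrr sqrtr0 mulr0.
  by move=> /esym/eqP; rewrite normr_eq0 (lt_eqF b0).
by rewrite cosN sinN acosK ?in_itv// sin_acos// am mulrN bm ltr0_norm// opprK.
Qed.

Lemma ArgP z : is_Arg z (Arg z).
Proof. by rewrite /Arg; case: xgetP => //=; have [t zt] := Arg_exists z => /(_ t). Qed.

End PrincipalArgument.

Section Indexation.
Context {R : realType}.

Definition Omega0 (alpha : R) : set R[i] :=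
  [set s | - (pi / ln alpha) < complex.Im s <= pi / ln alpha].

(* [others] is (alpha_2, ..., alpha_r): position [j : 'I_r.-1] of [others] and
   of a multi-index stands for the index [j + 2]. *)
Definition conj_power (r : nat) (others : r.-1.-tuple R[i])
    (kappa : {ffun 'I_r.-1 -> nat}) : R[i] :=
  \prod_(j < r.-1) tnth others j ^+ kappa j.

Definition s_kappa (alpha : R) (r : nat) (others : r.-1.-tuple R[i])
    (kappa : {ffun 'I_r.-1 -> nat}) : R[i] :=
  (- (\sum_(j < r.-1) kappa j)%N%:R
     + ln (modulus (conj_power others kappa)) / ln alpha)
  +i* (Arg (conj_power others kappa) / ln alpha).

Lemma s_kappa_Omega0 (alpha : R) (r : nat) (others : r.-1.-tuple R[i]) :
  Perron alpha ->
  set_fun [set: {ffun 'I_r.-1 -> nat}] (Omega0 alpha) (s_kappa alpha others).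
Proof.
case=> _ a1 _ kappa _; have [b _] := ArgP (conj_power others kappa).
have l0 : 0 < ln alpha by rewrite ln_gt0.
by rewrite /Omega0 /= -mulNr ltr_pM2r ?ler_pM2r ?invr_gt0.
Qed.

Definition indexation_map (alpha : R) (r : nat) (others : r.-1.-tuple R[i])
    (hP : Perron alpha) :
    {fun [set: {ffun 'I_r.-1 -> nat}] >-> Omega0 alpha} :=
  mkfun_fun (s_kappa_Omega0 others hP).

End Indexation.

(* Main.v *)
Require Import Defs.
From HB Require Import structures.
From mathcomp Require Import all_boot all_order all_algebra.
From mathcomp Require Import all_classical all_reals all_analysis.
From mathcomp Require Import complex.

Import Order.TTheory GRing.Theory Num.Theory.
Import numFieldNormedType.Exports.

Local Open Scope classical_set_scope.
Local Open Scope card_scope.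
Local Open Scope ring_scope.
Local Open Scope complex_scope.

(** The real part of $s_\kappa$ has the sign of $\log|\prod_j \alpha_j^{\kappa_j}| -
    |\kappa|\log\alpha$. Every $\alpha_j$ with $j \ge 2$ has modulus below $\alpha$, so this is
    negative as soon as one exponent is positive ([modulus_conj_power_lt], [Re_s_kappa_lt0]). Only
    $\kappa = 0$ can then be sent to $0$, and it is, because the product is $1$, whose logarithm and
    argument vanish ([s_kappa0]). *)

Section Modulus.
Context {R : realType}.
Implicit Types z w : R[i].

Lemma norm_modulus z : `|z| = (modulus z)%:C.
Proof. by rewrite modulusE normc_def. Qed.

Lemma modulus_ge0 z : 0 <= modulus z.
Proof. by rewrite modulusE sqrtr_ge0. Qed.

Lemma modulus1 : modulus (1 : R[i]) = 1.
Proof. by apply: complexI; rewrite -norm_modulus normr1. Qed.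

Lemma modulusM z w : modulus (z * w) = modulus z * modulus w.
Proof. by apply: complexI; rewrite rmorphM /= -!norm_modulus normrM. Qed.

Lemma modulusX z n : modulus (z ^+ n) = modulus z ^+ n.
Proof. by apply: complexI; rewrite rmorphXn /= -!norm_modulus normrX. Qed.

Lemma modulus_prod (I : Type) (s : seq I) (P : pred I) (F : I -> R[i]) :
  modulus (\prod_(i <- s | P i) F i) = \prod_(i <- s | P i) modulus (F i).
Proof. exact: (big_morph _ modulusM modulus1). Qed.

Lemma Arg1 : Arg (1 : R[i]) = 0.
Proof.
have [/andP[tgt tle]] := ArgP (1 : R[i]); set t := Arg 1 in tgt tle *.
rewrite modulus1 !mul1r => -[cost _].
(* Cosine is even, so [t] can be replaced by its absolute value, which lies in the interval where
   [acos] inverts [cos]. *)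
have t_pi : `|t| \in `[0, pi] by rewrite in_itv /= normr_ge0 ler_norml (ltW tgt).
have cosNt : cos `|t| = 1 by case: (ger0P t); rewrite ?cosN.
by apply/eqP; rewrite -normr_eq0 -(cosK t_pi) cosNt acos1.
Qed.

End Modulus.

(** By convention [ln] is $0$ on nonpositive reals, where the claim becomes $0 < \ln y$. In this
    form it applies to the modulus of a product without separating the case of modulus $0$. *)
Lemma ltr_ln_gt1 (R : realType) (x y : R) : x < y -> 1 < y -> ln x < ln y.
Proof.
move=> xy y1; have [x0|x0] := ltP 0 x; last by rewrite ln0// ln_gt0.
by rewrite ltr_ln ?posrE// (lt_trans x0).
Qed.

(** The two sides are compared factor by factor; one index [j] with a nonzero exponent makes the
    inequality strict. *)
Lemma modulus_conj_power_lt (R : realType) (alpha : R) (r : nat)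
    (others : r.-1.-tuple R[i]) (kappa : {ffun 'I_r.-1 -> nat}) :
  0 < alpha -> (forall j, modulus (tnth others j) < alpha) ->
  kappa != [ffun=> 0%N] ->
  modulus (conj_power others kappa) < alpha ^+ (\sum_(j < r.-1) kappa j)%N.
Proof.
move=> a0 others_lt k0; have [j kj] : exists j, kappa j != 0%N.
  apply/existsP; apply: contraNT k0 => /existsPn k0.
  by apply/eqP/ffunP => j; rewrite ffunE; have /negPn/eqP := k0 j.
rewrite /conj_power modulus_prod -prodrXr (bigD1 j)//= [ltRHS](bigD1 j)//=.
rewrite modulusX; set x := \prod_(_ | _) modulus _.
have x_le : x <= \prod_(i | i != j) alpha ^+ kappa i.
  apply: ler_prod => i _; rewrite modulus_ge0 modulusX.
  by rewrite lerXn2r ?nnegrE ?modulus_ge0 ?ltW.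
(* The cofactor [x] is first enlarged to a product of powers of [alpha]: that product is positive,
   so cancelling it keeps the strict inequality at [j]. *)
apply: le_lt_trans (ler_wpM2l (exprn_ge0 _ (modulus_ge0 _)) x_le) _.
rewrite ltr_pM2r; first by rewrite ltrXn2r ?modulus_ge0.
by apply: prodr_gt0 => i _; rewrite exprn_gt0.
Qed.

Lemma s_kappa0 (R : realType) (alpha : R) (r : nat)
    (others : r.-1.-tuple R[i]) :
  s_kappa alpha others [ffun=> 0%N] = 0.
Proof.
rewrite /s_kappa /conj_power.
under eq_bigr do rewrite ffunE.
under [\prod_(_ < _) _]eq_bigr do rewrite ffunE.
by rewrite !big1_eq modulus1 Arg1 ln1 !mul0r oppr0 addr0.
Qed.

Lemma Re_s_kappa_lt0 (R : realType) (alpha : R) (r : nat)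
    (others : r.-1.-tuple R[i]) (kappa : {ffun 'I_r.-1 -> nat}) :
  1 < alpha -> (forall j, modulus (tnth others j) < alpha) ->
  kappa != [ffun=> 0%N] ->
  complex.Re (s_kappa alpha others kappa) < 0.
Proof.
move=> a1 others_lt k0; have a0 : 0 < alpha by apply: lt_trans a1.
(* Multiplying by $\log\alpha > 0$ turns the goal into $\log|\prod_j \alpha_j^{\kappa_j}| < \log
   \alpha^{|\kappa|}$. *)
rewrite /= addrC subr_lt0 ltr_pdivrMr ?ln_gt0// mulr_natl -lnXn//.
apply: ltr_ln_gt1; first exact: modulus_conj_power_lt.
(* It remains to see $\alpha^{|\kappa|} > 1$, that is $|\kappa| \ne 0$: a vanishing sum of naturals
   has only zero terms. *)
rewrite exprn_egt1//; apply: contraNneq k0 => /eqP.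
rewrite sum_nat_eq0 => /forallP k0; apply/eqP/ffunP => j.
by rewrite ffunE; apply/eqP; exact: k0.
Qed.

Theorem proposition6p2 (R : realType) (alpha : R) (r : nat)
    (others : r.-1.-tuple R[i])
    (hP : Perron alpha)
    (hdeg : degreeQ alpha%:C r)
    (hconj : lists_conjugatesQ alpha%:C (alpha%:C :: others)) :
  indexation_map others hP @^-1` [set 0] #= `I_1.
Proof.
have [_ a1 conj_lt] := hP; have [/andP[alphaN _] conjE] := hconj.
(* Absence of repetition in the list keeps [alpha] out of [others], so the Perron bound applies to
   each entry. *)
have others_lt j : modulus (tnth others j) < alpha.
  apply: conj_lt; first by apply/conjE; rewrite inE mem_tnth orbT.
  by apply: contraNneq alphaN => <-; exact: mem_tnth.
suff -> : indexation_map others hP @^-1` [set 0] = [set [ffun=> 0%N]].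
  exact: card_set1.
apply/seteqP; split=> [kappa /= s0|_ ->]; last exact: s_kappa0.
apply/eqP; apply: contraT => /(Re_s_kappa_lt0 _ _ _ _ _ a1 others_lt).
by rewrite [s_kappa _ _ _]s0 ltxx.
Qed.
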